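(* Let $\mathbb{F}$ be an algebraically closed field and let $n,t\in\mathbb{Z}^+$. Let $\mathcal{S}$ be a generating system of the full matrix algebra $\mathrm{M}_n(\mathbb{F})$. If $2t\le n\le 3t-1$ and $m(\mathcal{S})=t$, then $\ell(\mathcal{S})\le \frac{7n}{2}-4$.
   Context: $\mathrm{M}_n(\mathbb{F})$ is the algebra of $n\times n$ matrices over $\mathbb{F}$. Let $\mathcal{S}$ be a finite subset of $\mathrm{M}_n(\mathbb{F})$. A word of length $j$ in $\mathcal{S}$ is a product of $j$ elements of $\mathcal{S}$ (repetitions allowed); the identity matrix is regarded as the (empty) word of length $0$. For $i\ge 0$, $L_i(\mathcal{S})$ denotes the $\mathbb{F}$-linear span of all words in $\mathcal{S}$ of length at most $i$, so $L_0(\mathcal{S})$ is the set of scalar matrices. $L(\mathcal{S})=\bigcup_{i\ge 0}L_i(\mathcal{S})$. $\mathcal{S}$ is a generating system of $\mathrm{M}_n(\mathbb{F})$ if $L(\mathcal{S})=\mathrm{M}_n(\mathbb{F})$. The length $\ell(\mathcal{S})$ of a generating system $\mathcal{S}$ is the minimum non-negative integer $i$ such that $L_i(\mathcal{S})=\mathrm{M}_n(\mathbb{F})$. For a matrix $w$, $\deg w$ denotes the degree of the minimal polynomial of $w$ over $\mathbb{F}$, and $m(\mathcal{S})=\max\{\deg w : w\in\mathcal{S}\}$. *)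

(* Defs.v *)
From HB Require Import structures.
From mathcomp Require Import all_boot all_order all_algebra.
From mathcomp Require Import finmap.

Set Implicit Arguments.
Unset Strict Implicit.
Unset Printing Implicit Defensive.

Import GRing.Theory.
Local Open Scope ring_scope.

Section MatrixLength.

Variables (F : fieldType) (n' : nat).

(* [degree_mxminpoly] is only available for matrices of visibly positive size. *)
Local Notation n := n'.+1.

Implicit Types (S : {fset 'M[F]_n}) (i j : nat).

Definition words S j : seq 'M[F]_n :=
  [seq \prod_(a <- u) val a | u : j.-tuple S].

Definition Lspan S i : {vspace 'M[F]_n} :=
  <<flatten [seq words S j | j <- iota 0 i.+1]>>%VS.

Definition generating S : Prop :=
  forall A : 'M[F]_n, exists i, A \in Lspan S i.

Lemma Lspan_mono S i j : (i <= j)%N -> (Lspan S i <= Lspan S j)%VS.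
Proof.
move=> le_ij; apply: sub_span => A /flatten_mapP[k].
rewrite mem_iota add0n => /andP[_ lt_ki] Ak; apply/flatten_mapP; exists k => //.
by rewrite mem_iota add0n /=; apply: leq_trans lt_ki _.
Qed.

Lemma generating_fullv S : generating S -> exists i, Lspan S i == fullv.
Proof.
move=> genS.
have sub_gen (X : seq 'M[F]_n) : exists i, {subset X <= Lspan S i}.
  elim: X => [|A X [i sXi]]; first by exists 0%N.
  have [j Aj] := genS A; exists (maxn i j) => B; rewrite inE => /predU1P[->|XB].
    exact: subvP (Lspan_mono S (leq_maxr i j)) _ Aj.
  exact: subvP (Lspan_mono S (leq_maxl i j)) _ (sXi B XB).
have [i sXi] := sub_gen (vbasis fullv).
exists i; rewrite eqEsubv subvf /= -(span_basis (vbasisP fullv)).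
exact/span_subvP.
Qed.

Definition gen_length S (genS : generating S) : nat :=
  ex_minn (generating_fullv genS).

Definition max_deg S : nat := \max_(A <- S) degree_mxminpoly A.

End MatrixLength.

(* Main.v *)
(* A rank 1 matrix in [L_k] forces [L_(k + 2n - 2)] to be everything, because
   the images of [L_(n - 1)] on a nonzero row or column fill the whole space;
   it is therefore enough to find one with k = n + t - 2. Let A in S have
   degree t, and multiply the t linear factors of its minimal polynomial one
   after the other: the rank decreases from n < 3t to 0 in t positive steps, so
   some step is at most 2, and omitting the corresponding factor gives B <> 0 of
   rank at most 2 in [L_(t - 1)]. If B = C R has rank 2, the space
   X = R [L_(n - t)] of 2 x n matrices has dimension greater than n - t. Filter X
   by the kernels of the partial products g(A) of the minimal polynomial: if
   no x g(A), x in X, had rank 1, each step would contribute to dim X less than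
   the drop of the rank of g(A), so that dim X <= n - t. Hence some B w g(A) with
   w in [L_(n - t)] and deg g < t has rank 1. *)
Require Import Defs.
From HB Require Import structures.
From mathcomp Require Import all_boot all_order all_algebra.
From mathcomp Require Import finmap.
From mathcomp Require Import zify lra.

Set Implicit Arguments.
Unset Strict Implicit.
Unset Printing Implicit Defensive.

Import Order.TTheory GRing.Theory Num.Theory.
Local Open Scope ring_scope.

(** * Spans of words and their images on rows and columns *)

Section WordSpans.

Variables (F : fieldType) (n' : nat) (S : {fset 'M[F]_n'.+1}).

Local Notation n := n'.+1.
Local Notation L := (Lspan S).

Definition word_prod (u : seq S) : 'M[F]_n := \prod_(a <- u) val a.

Lemma word_in_Lspan (u : seq S) i : (size u <= i)%N -> word_prod u \in L i.
Proof.
move=> le_u_i; apply/memv_span/flatten_mapP; exists (size u).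
  by rewrite mem_iota.
by apply/imageP; exists (in_tuple u).
Qed.

Lemma Lspan_subv i (U : {vspace 'M[F]_n}) :
  (forall u : seq S, (size u <= i)%N -> word_prod u \in U) -> (L i <= U)%VS.
Proof.
move=> wordsU; apply/span_subvP => x /flatten_mapP[j].
rewrite mem_iota /= add0n ltnS => le_j_i /imageP[u _ ->].
by apply: wordsU; rewrite size_tuple.
Qed.

Lemma Lspan1 i : 1 \in L i.
Proof.
have := word_in_Lspan (isT : (size [::] <= i)%N).
by rewrite /word_prod big_nil.
Qed.

Lemma Lspan_gen a : a \in S -> a \in L 1.
Proof.
move=> aS; have := word_in_Lspan (isT : (size [:: [` aS]%fset] <= 1)%N).
by rewrite /word_prod big_seq1.
Qed.

Lemma Lspan_mul x y i j : x \in L i -> y \in L j -> x * y \in L (i + j)%N.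
Proof.
move=> xLi yLj.
have wordL u : (size u <= i)%N -> word_prod u * y \in L (i + j)%N.
  move=> le_u_i.
  have: (L j <= linfun (mulmx (word_prod u)) @^-1: L (i + j)%N)%VS.
    apply: Lspan_subv => v le_v_j; rewrite -memv_preim lfunE /=.
    have := @word_in_Lspan (u ++ v) (i + j); rewrite /word_prod big_cat.
    by apply; rewrite size_cat leq_add.
  by move/subvP/(_ y yLj); rewrite -memv_preim lfunE.
have: (L i <= linfun (mulmxr y) @^-1: L (i + j)%N)%VS.
  by apply: Lspan_subv => u le_u_i; rewrite -memv_preim lfunE /=; apply: wordL.
by move/subvP/(_ x xLi); rewrite -memv_preim lfunE.
Qed.

Hypothesis genS : generating S.

(* If the image of [L (i + 1)] is that of [L i], then every later one is too,
   so the dimension grows by at least 1 at every step until it is maximal. *)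
Lemma Lspan_img_dim (V : vectType F) (f : 'Hom('M[F]_n, V)) i :
    f 1 != 0 -> limg f = fullv ->
    (forall j, (f @: L j.+1 <= f @: L j)%VS ->
       (f @: L j.+2 <= f @: L j.+1)%VS) ->
  (i < \dim (f @: L i))%N \/ (f @: L i)%VS = fullv.
Proof.
move=> f1 f_onto f_stat.
have [N /eqP LN] := generating_fullv genS.
have stat_full j : (f @: L j.+1 <= f @: L j)%VS -> (f @: L j)%VS = fullv.
  move=> st; have st' k : (f @: L (k + j).+1 <= f @: L (k + j)%N)%VS.
    by elim: k => [|k IHk] //; rewrite addSn; apply: f_stat.
  have all_sub k : (f @: L (k + j)%N <= f @: L j)%VS.
    by elim: k => [|k IHk] //; rewrite addSn; apply: subv_trans (st' k) IHk.
  apply/eqP; rewrite eqEsubv subvf /= -f_onto -LN.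
  by apply: subv_trans (all_sub N); apply/limgS/Lspan_mono/leq_addr.
elim: i => [|i IHi].
  left; rewrite lt0n dimv_eq0; apply: contra f1 => /eqP D0.
  by rewrite -memv0 -D0 memv_img ?Lspan1.
have [/stat_full full_i|nst] := boolP (f @: L i.+1 <= f @: L i)%VS.
  right; apply/eqP; rewrite eqEsubv subvf -full_i /=.
  exact/limgS/Lspan_mono.
left; case: IHi => [lt_i|full_i]; last by rewrite full_i subvf in nst.
apply: leq_ltn_trans lt_i _.
have sub : (f @: L i <= f @: L i.+1)%VS by apply/limgS/Lspan_mono.
rewrite ltn_neqAle dimvS // andbT; apply: contra nst => eq_dim.
suff /eqP <- : (f @: L i == f @: L i.+1)%VS by [].
by rewrite eqEdim sub (eqP eq_dim) /=.
Qed.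

(** Splitting off the last letter of a word works because right multiplication by a letter commutes
    with left multiplication by [R]. Used with [p] equal to 1 and to 2. *)
Lemma row_orbit_dim p (R : 'M[F]_(p, n)) i : (0 < p)%N -> row_free R ->
  (i < \dim (linfun (mulmx R) @: L i))%N
    \/ (linfun (mulmx R) @: L i)%VS = fullv.
Proof.
move=> p_gt0 freeR; apply: Lspan_img_dim.
- rewrite lfunE /= mulmx1; apply: contraTneq freeR => ->.
  by rewrite /row_free mxrank0 eq_sym -lt0n.
- apply/eqP; rewrite eqEsubv subvf; apply/subvP => M _; apply/memv_imgP.
  by exists (pinvmx R *m M); rewrite ?memvf // lfunE /= mulmxA mulmxVp ?mul1mx.
move=> j /subvP st; apply/subvP => _ /memv_imgP[w Lw ->]; move: w Lw.
suff /subvP sub :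
    (L j.+2 <= linfun (mulmx R) @^-1: (linfun (mulmx R) @: L j.+1))%VS.
  by move=> w /sub; rewrite -memv_preim.
apply: Lspan_subv => u; rewrite -memv_preim.
case/lastP: u => [_|u a]; first by rewrite /word_prod big_nil memv_img ?Lspan1.
rewrite size_rcons ltnS => /word_in_Lspan Lu.
have /memv_imgP[y Ly] := st _ (memv_img _ Lu); rewrite !lfunE /= => eq_Ru.
rewrite /word_prod -cats1 big_cat big_seq1 /= mulmxA eq_Ru -mulmxA.
have -> : R *m (y *m val a) = linfun (mulmx R) (y * val a) by rewrite lfunE.
apply: memv_img; rewrite -[j.+1]addn1.
by apply: Lspan_mul => //; apply/Lspan_gen/valP.
Qed.

Lemma col_orbit_dim p (C : 'M[F]_(n, p)) i : (0 < p)%N -> row_full C ->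
  (i < \dim (linfun (mulmxr C) @: L i))%N
    \/ (linfun (mulmxr C) @: L i)%VS = fullv.
Proof.
move=> p_gt0 fullC; apply: Lspan_img_dim.
- rewrite lfunE /= mul1mx; apply: contraTneq fullC => ->.
  by rewrite /row_full mxrank0 eq_sym -lt0n.
- apply/eqP; rewrite eqEsubv subvf; apply/subvP => M _; apply/memv_imgP.
  by exists (M *m pinvmx C); rewrite ?memvf // lfunE /= -mulmxA mulVpmx ?mulmx1.
move=> j /subvP st; apply/subvP => _ /memv_imgP[w Lw ->]; move: w Lw.
suff /subvP sub :
    (L j.+2 <= linfun (mulmxr C) @^-1: (linfun (mulmxr C) @: L j.+1))%VS.
  by move=> w /sub; rewrite -memv_preim.
apply: Lspan_subv => u; rewrite -memv_preim.
case: u => [_|a u]; first by rewrite /word_prod big_nil memv_img ?Lspan1.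
rewrite /= ltnS => /word_in_Lspan Lu.
have /memv_imgP[y Ly] := st _ (memv_img _ Lu); rewrite !lfunE /= => eq_uC.
rewrite /word_prod big_cons /= -mulmxA eq_uC mulmxA.
have -> : val a *m y *m C = linfun (mulmxr C) (val a * y) by rewrite lfunE.
apply: memv_img; rewrite -[j.+1]add1n.
by apply: Lspan_mul => //; apply/Lspan_gen/valP.
Qed.

(** With [P = c *m r], the products [x * P * y] are [(x *m c) *m (r *m y)]; as [x] and [y] range
    over [L n'], they include all matrix units. *)
Lemma rank1_Lspan_full P k : P \in L k -> \rank P = 1%N ->
  L (n' + k + n')%N = fullv.
Proof.
move=> LP rkP.
have [c [r [fullc freer PE]]] : exists (c : 'M_(n, 1)) (r : 'M_(1, n)),
    [/\ row_full c, row_free r & P = c *m r].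
  by rewrite -rkP; exists (col_base P), (row_base P);
    rewrite col_base_full row_base_free mulmx_base.
have full_c : (linfun (mulmxr c) @: L n')%VS = fullv.
  case: (@col_orbit_dim 1 c n' isT fullc) => // lt; apply/eqP.
  by rewrite eqEdim subvf dimvf dim_matrix mulr1.
have full_r : (linfun (mulmx r) @: L n')%VS = fullv.
  case: (@row_orbit_dim 1 r n' isT freer) => // lt; apply/eqP.
  by rewrite eqEdim subvf dimvf dim_matrix mul1r.
apply/eqP; rewrite eqEsubv subvf /=; apply/subvP => M _.
rewrite [M]matrix_sum_delta; apply: memv_suml => i _; apply: memv_suml => j _.
apply: memvZ.
have: delta_mx i (0 : 'I_1) \in (linfun (mulmxr c) @: L n')%VS.
  by rewrite full_c memvf.
case/memv_imgP => x Lx; rewrite lfunE /= => xE.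
have: delta_mx (0 : 'I_1) j \in (linfun (mulmx r) @: L n')%VS.
  by rewrite full_r memvf.
case/memv_imgP => y Ly; rewrite lfunE /= => yE.
rewrite -(mul_delta_mx (0 : 'I_1)) xE yE.
have -> : x *m c *m (r *m y) = x * P * y by rewrite PE -!mulmxE !mulmxA.
by rewrite !Lspan_mul.
Qed.

End WordSpans.

(* A pencil argument: let [P0], [P1] collect the first and second rows of a
   basis of [Z]. If [P0] is not row free, some element of [Z] has first row 0;
   otherwise [P1 = T *m P0] and an eigenvector of [T] gives an element of [Z]
   with proportional rows. *)
Lemma exists_rank1 (F : closedFieldType) m k (E : 'M[F]_(m, k))
    (Z : {vspace 'M[F]_(1 + 1, k)}) :
    (forall z, z \in Z -> (z <= E)%MS) -> (0 < \rank E <= \dim Z)%N ->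
  exists2 z, z \in Z & \rank z = 1%N.
Proof.
move=> ZE /andP[E_gt0 le_E_Z].
have d_gt0 := leq_trans E_gt0 le_E_Z; set d := \dim Z in le_E_Z d_gt0 *.
have ZbZ (i : 'I_d) : (vbasis Z)`_i \in Z.
  by apply: vbasis_mem; rewrite mem_nth ?size_tuple.
pose comb (v : 'rV[F]_d) := \sum_(i < d) v 0 i *: (vbasis Z)`_i.
have combZ v : comb v \in Z by apply: memv_suml => i _; apply/memvZ/ZbZ.
have comb0 v : comb v = 0 -> v = 0.
  move=> cv0; have /freeP fr := basis_free (vbasisP Z).
  by apply/rowP => i; rewrite mxE (fr (v 0)).
pose P0 := \matrix_(i < d) usubmx (vbasis Z)`_i.
pose P1 := \matrix_(i < d) dsubmx (vbasis Z)`_i.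
have comb_u v : usubmx (comb v) = v *m P0.
  rewrite mulmx_sum_row linear_sum; apply: eq_bigr => i _.
  by rewrite linearZ rowK.
have comb_d v : dsubmx (comb v) = v *m P1.
  rewrite mulmx_sum_row linear_sum; apply: eq_bigr => i _.
  by rewrite linearZ rowK.
have rank1_comb (v : 'rV_d) w a b :
    v != 0 -> v *m P0 = a *: w -> v *m P1 = b *: w ->
  exists2 z, z \in Z & \rank z = 1%N.
  move=> v_neq0 vP0 vP1; exists (comb v) => //; apply/eqP.
  rewrite eqn_leq lt0n mxrank_eq0; apply/andP; split; last first.
    by apply: contra v_neq0 => /eqP/comb0->.
  rewrite -[comb v]vsubmxK comb_u comb_d vP0 vP1 -!mul_scalar_mx -mul_col_mx.
  exact: mulmx_max_rank.
have subE z : z \in Z -> (usubmx z <= E)%MS /\ (dsubmx z <= E)%MS.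
  by move/ZE; rewrite -{1}[z]vsubmxK col_mx_sub => /andP[].
have P0E : (P0 <= E)%MS.
  by apply/row_subP => i; rewrite rowK; case: (subE _ (ZbZ i)).
have P1E : (P1 <= E)%MS.
  by apply/row_subP => i; rewrite rowK; case: (subE _ (ZbZ i)).
have [/eqP rkP0|] := boolP (row_free P0); last first.
  rewrite -kermx_eq0 => /rowV0Pn[v /sub_kermxP vP0 v_neq0].
  by apply: (rank1_comb v (v *m P1) 0 1); rewrite ?scale0r ?scale1r.
(* [P0] has rank [d], at least [\rank E], so its row space is that of [E], which contains the rows
   of [P1]. *)
have P1P0 : (P1 <= P0)%MS.
  apply: submx_trans P1E _.
  by rewrite -(geq_leqif (mxrank_leqif_sup P0E)) rkP0.
have /closed_rootP[a] : size (char_poly (P1 *m pinvmx P0)) != 1%N.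
  by rewrite size_char_poly; case: (d) d_gt0.
rewrite -eigenvalue_root_char => /eigenvalueP[v v_eig v_neq0].
apply: (rank1_comb v (v *m P0) 1 a); rewrite ?scale1r //.
by rewrite scalemxAl -v_eig -mulmxA mulmxKpV.
Qed.

(** * Products of linear factors in one matrix *)

Section RootProducts.

Variables (F : closedFieldType) (n' : nat) (A : 'M[F]_n'.+1).

Local Notation n := n'.+1.

(** Multiplying polynomials before evaluating at [A] lets the factors be permuted freely. *)
Definition root_prod (s : seq F) : 'M[F]_n :=
  horner_mx A (\prod_(z <- s) ('X - z%:P)).

Local Notation G := root_prod.
Local Notation ker z := (kermx (A - z%:M)).

Lemma root_prod_nil : G [::] = 1.
Proof. by rewrite /root_prod big_nil rmorph1. Qed.

Lemma root_prod_cat p q : G (p ++ q) = G p * G q.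
Proof. by rewrite /root_prod big_cat rmorphM. Qed.

Lemma root_prod_catC p q : G (p ++ q) = G (q ++ p).
Proof. by rewrite /root_prod !big_cat /= mulrC. Qed.

Lemma root_prod_seq1 z : G [:: z] = A - z%:M.
Proof. by rewrite /root_prod big_seq1 rmorphB /= horner_mx_X horner_mx_C. Qed.

Lemma rank_root_prod_rcons p z :
  (\rank (G (rcons p z)) + \rank (G p :&: ker z)%MS)%N = \rank (G p).
Proof. by rewrite -cats1 root_prod_cat root_prod_seq1 mxrank_mul_ker. Qed.

(** The factors commute, so the rows of [G (p ++ q)] lie in the row space of [G p] and are killed by
    [A - z%:M]. *)
Lemma rank_cofactor_le p z q : G (p ++ z :: q) = 0 ->
  (\rank (G (p ++ q)) <= \rank (G p :&: ker z)%MS)%N.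
Proof.
move=> G0; apply: mxrankS; rewrite root_prod_catC sub_capmx.
rewrite {1}root_prod_cat submxMl /= sub_kermx -root_prod_seq1 mulmxE.
by rewrite -root_prod_cat -catA root_prod_catC -catA G0.
Qed.

(** If every factor lowered the rank by at least 3, [3 * size s + \rank (G s)] would never exceed
    its initial value [n]. *)
Lemma small_rank_drop s : (n < 3 * size s + \rank (G s))%N ->
  exists p z q, s = p ++ z :: q /\ (\rank (G p :&: ker z)%MS <= 2)%N.
Proof.
elim/last_ind: s => [|s z IHs]; first by rewrite root_prod_nil mxrank1 ltnn.
have [le2|gt2] := leqP (\rank (G s :&: ker z)%MS) 2.
  by exists s, z, [::]; rewrite cats1.
rewrite size_rcons; have := rank_root_prod_rcons s z => rk_s lt_n.
have [|p [y [q [-> le2]]]] := IHs; first by lia.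
by exists p, y, (rcons q z); rewrite rcons_cat.
Qed.

(* Without rank 1 elements, extending [s] by [z] would enlarge the kernel of
   [G s] in [X] by less than [\rank (G s :&: ker z)], by [exists_rank1], hence
   the sum bounded below would stay at most [n]. *)
Lemma exists_rank1_root_prod (X : {vspace 'M[F]_(1 + 1, n)}) s :
    (forall p z q, s = p ++ z :: q -> (0 < \rank (G p :&: ker z)%MS)%N) ->
    (n < \dim (X :&: lker (linfun (mulmxr (G s)))) + size s + \rank (G s))%N ->
  exists p z q, s = p ++ z :: q /\ exists2 x, x \in X & \rank (x *m G p) = 1%N.
Proof.
elim/last_ind: s => [_|s z IHs drop_gt0].
  have -> : (X :&: lker (linfun (mulmxr (G [::]))) = 0)%VS.
    apply/eqP; rewrite -subv0; apply/subvP => x /memv_capP[_].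
    by rewrite memv_ker lfunE /= root_prod_nil mulmx1 memv0.
  by rewrite root_prod_nil mxrank1 dimv0 ltnn.
set K := (X :&: _)%VS.
pose f := linfun (mulmxr (G s)) : 'Hom('M[F]_(1 + 1, n), 'M[F]_(1 + 1, n)).
have [le_fK|lt_fK] := leqP (\rank (G s :&: ker z)%MS) (\dim (f @: K)).
  move=> _; exists s, z, [::]; split; first by rewrite cats1.
  have [||_ /memv_imgP[x /memv_capP[Xx _] ->]] :=
    @exists_rank1 F _ _ (G s :&: ker z)%MS (f @: K)%VS.
  - move=> _ /memv_imgP[x /memv_capP[_ Kx] ->]; rewrite lfunE /=.
    rewrite sub_capmx submxMl sub_kermx -mulmxA mulmxE -root_prod_seq1.
    by rewrite -root_prod_cat cats1; move: Kx; rewrite memv_ker lfunE.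
  - by rewrite le_fK andbT (drop_gt0 s z [::]) ?cats1.
  by rewrite lfunE; exists x.
(* By rank-nullity for [f] on [K], removing [z] does not decrease the sum, so the induction
   hypothesis applies to [s]. *)
have leK : (\dim (K :&: lker f) <= \dim (X :&: lker f))%N.
  by rewrite dimvS ?capvS ?capvSl.
rewrite size_rcons => lt_n.
have [||p [y [q [-> x_rk]]]] := IHs.
- by move=> p y q sE; apply: (drop_gt0 p y (rcons q z)); rewrite sE rcons_cat.
- rewrite -/f; have := limg_ker_dim f K; have := rank_root_prod_rcons s z.
  move: lt_fK leK lt_n.
  move: (\dim (f @: K)) (\dim (K :&: lker f)) (\dim (X :&: lker f)) (\dim K).
  by move: (\rank (G s :&: ker z)) (\rank (G (rcons s z))); lia.
by exists p, y, (rcons q z); rewrite rcons_cat.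
Qed.

End RootProducts.

(** * The rank 1 matrix and the length bound *)

Lemma root_prod_Lspan (F : closedFieldType) n' (S : {fset 'M[F]_n'.+1}) A s :
  A \in S -> root_prod A s \in Lspan S (size s).
Proof.
move=> AS; elim: s => [|z s IHs]; first by rewrite root_prod_nil Lspan1.
rewrite -cat1s root_prod_cat /= -[(size s).+1]add1n.
apply: Lspan_mul IHs; rewrite root_prod_seq1 -scalemx1.
by apply: memvB; [apply: Lspan_gen | apply/memvZ/Lspan1].
Qed.

Lemma mxminpoly_roots (F : closedFieldType) n' (A : 'M[F]_n'.+1) :
  exists s : seq F, [/\ size s = degree_mxminpoly A, root_prod A s = 0
    & forall r, (size r < size s)%N -> root_prod A r != 0].
Proof.
have [s] := closed_field_poly_normal (mxminpoly A).
rewrite (monicP (mxminpoly_monic A)) scale1r => sE.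
have size_s : size s = degree_mxminpoly A.
  by apply: succn_inj; rewrite -size_mxminpoly sE size_prod_XsubC.
exists s; split=> // [|r lt_r_s].
  by rewrite /root_prod -sE mx_root_minpoly.
apply/eqP => /mxminpoly_min/dvdp_leq; rewrite size_mxminpoly size_prod_XsubC.
rewrite -size_s ltnS leqNgt lt_r_s => /(_ _)/negP; apply=> //.
by rewrite monic_neq0 ?monic_prod_XsubC.
Qed.

Lemma rank1_in_Lspan (F : closedFieldType) n' (S : {fset 'M[F]_n'.+1}) A :
  let n := n'.+1 in let t := degree_mxminpoly A in
  generating S -> A \in S -> (t <= n < 3 * t)%N ->
  exists2 P, P \in Lspan S (t.-1 + (n - t) + t.-1) & \rank P = 1%N.
Proof.
move=> n t genS AS /andP[le_tn lt_n3t].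
have [s [size_s Gs0 minG]] := mxminpoly_roots A.
have [|p [z [q [sE le2]]]] := @small_rank_drop F n' A s.
  by rewrite size_s; lia.
pose B := root_prod A (p ++ q).
have size_pq : size (p ++ q) = t.-1 by rewrite /t -size_s sE !size_cat /= addnS.
have LB : B \in Lspan S t.-1 by rewrite -size_pq root_prod_Lspan.
(* Every factor strictly lowers the rank, since omitting it leaves a nonzero product by
   minimality. *)
have cof p1 z1 q1 : s = p1 ++ z1 :: q1 ->
    (0 < \rank (root_prod A p1 :&: kermx (A - z1%:M))%MS)%N.
  move=> sE1; apply: leq_trans (@rank_cofactor_le F n' A p1 z1 q1 _).
    2: by rewrite -sE1.
  by rewrite lt0n mxrank_eq0 minG // sE1 !size_cat /=; lia.
have rkB_le2 : (\rank B <= 2)%N.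
  by apply: leq_trans le2; apply: rank_cofactor_le; rewrite -sE.
have rkB_gt0 : (0 < \rank B)%N by rewrite lt0n mxrank_eq0 minG ?size_pq; lia.
have [rkB1|rkB2] : \rank B = 1%N \/ \rank B = 2%N by lia.
  by exists B => //; apply: subvP LB; apply: Lspan_mono; lia.
have [C [R [fullC freeR BE]]] :
    exists (C : 'M[F]_(n, 1 + 1)) (R : 'M[F]_(1 + 1, n)),
    [/\ row_full C, row_free R & B = C *m R].
  have -> : (1 + 1 = \rank B)%N by rewrite rkB2.
  by exists (col_base B), (row_base B);
    rewrite col_base_full row_base_free mulmx_base.
pose X := (linfun (mulmx R) @: Lspan S (n - t))%VS.
(* If [X] is the whole space, its dimension is [2 * n]. In both cases [\dim X + t] exceeds [n]. *)
have dimX : (n - t < \dim X)%N.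
  have [//|] := @row_orbit_dim F n' S genS (1 + 1) R (n - t) isT freeR.
  by rewrite -/X => ->; rewrite dimvf dim_matrix; lia.
have [|p1 [z1 [q1 [sE1 [_ /memv_imgP[w Lw ->]]]]]] :=
  @exists_rank1_root_prod F n' A X s cof.
  have -> : (X :&: lker (linfun (mulmxr (root_prod A s))) = X)%VS.
    apply/capv_idPl/subvP => x _.
    by rewrite memv_ker lfunE /= Gs0 mulmx0.
  by rewrite Gs0 mxrank0 addn0 size_s addnC -ltn_subLR.
rewrite lfunE /= => rk1; exists (B * w * root_prod A p1); last first.
  (* Left multiplication by the full column rank [C] preserves rank. *)
  by rewrite -mulmxE BE -mulmxA -mulmxA eqmxMfull ?mulmxA.
have le_p1 : (t.-1 + (n - t) + size p1 <= t.-1 + (n - t) + t.-1)%N.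
  by move: size_s; rewrite sE1 size_cat /= -/t; lia.
apply: (subvP (Lspan_mono S le_p1)).
by apply: Lspan_mul (root_prod_Lspan p1 AS); apply: Lspan_mul.
Qed.

(** Positivity excludes the default value 0 of an empty maximum. *)
Lemma max_deg_attained (F : fieldType) n' (S : {fset 'M[F]_n'.+1}) :
  (0 < max_deg S)%N -> exists2 A, A \in S & degree_mxminpoly A = max_deg S.
Proof.
rewrite /max_deg big_seq; elim/big_ind: _ => // [x y IHx IHy|A AS].
  2: by exists A.
by case: (leqP x y) => _; [apply: IHy | apply: IHx].
Qed.

Theorem theorem1p4 (F : closedFieldType) (n' t : nat)
    (S : {fset 'M[F]_n'.+1}) (genS : generating S) :
  let n := n'.+1 in
  (0 < t)%N ->
  (2 * t <= n <= 3 * t - 1)%N ->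
  max_deg S = t ->
  (gen_length genS)%:R <= 7%:R * n%:R / 2%:R - 4%:R :> rat.
Proof.
move=> n t_gt0 /andP[le_2t_n le_n_3t] max_t.
have [A AS degA] : exists2 A, A \in S & degree_mxminpoly A = t.
  by rewrite -max_t; apply: max_deg_attained; rewrite max_t.
have [|P LP rkP] := @rank1_in_Lspan F n' S A genS AS.
  by rewrite degA -/n; lia.
have full := rank1_Lspan_full genS LP rkP.
have : (gen_length genS <= n' + (t.-1 + (n - t) + t.-1) + n')%N.
  rewrite /gen_length; case: ex_minnP => l _; apply.
  by rewrite -degA full.
move: (gen_length genS) => l le_l.
(* The bound on [l] equals [3 * n + t - 4], and [2 * t <= n]. *)
have : (2 * (l + 4) <= 7 * n)%N by rewrite /n; lia.
by rewrite -(ler_nat rat) !natrM natrD; lra.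
Qed.
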